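(* Let $\Phi\subset\mathbb{R}^3$ be a skew ruled surface of class $C^3$, parametrized by $\boldsymbol{x}(u,v)=\boldsymbol{s}(u)+v\,\boldsymbol{e}(u)$, $(u,v)\in I\times\mathbb{R}$, as in the context, with conical curvature $k(u)$, distribution parameter $\delta(u)$ and $w=\sqrt{v^2+\delta(u)^2}$. Suppose that the normal curvature $k_N$ along the orthogonal trajectories of the curves of constant striction distance (i.e. of the curves $v=\text{const}$) has the form $$k_N=f(u)\,w^{n}\qquad\text{at every point }(u,v)\in I\times\mathbb{R},$$ with some $n\in\mathbb{Z}$ and some continuous function $f:I\to\mathbb{R}$. Then one of the following holds: (a) $f=0$ and $\Phi$ is an orthoid. (b) $n=-3$, $f(u)=\delta^2(u)\,k^{-1}(u)$, and $\Phi$ is an Edlinger surface.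
   Context: Setting. $I\subset\mathbb{R}$ is an open interval and $\Phi$ is a regular ruled surface in Euclidean space $\mathbb{R}^3$ without torsal generators (''skew''), of class $C^3$ on $I\times\mathbb{R}$, with parametrization $\boldsymbol{x}(u,v)=\boldsymbol{s}(u)+v\,\boldsymbol{e}(u)$, where $\boldsymbol{s}$ is the striction line and $\boldsymbol{e}$ is the unit vector along the generators. Prime denotes $d/du$. It is assumed that $\langle \boldsymbol{s}'(u),\boldsymbol{e}'(u)\rangle=0$ and $|\boldsymbol{e}'(u)|=1$ for all $u\in I$. Moving frame: $\boldsymbol{n}:=\boldsymbol{e}'$, $\boldsymbol{z}:=\boldsymbol{e}\times\boldsymbol{n}$. Invariants (with $(\cdot,\cdot,\cdot)$ the triple product): conical curvature $k=(\boldsymbol{e},\boldsymbol{e}',\boldsymbol{e}'')$; distribution parameter (Drall) $\delta=(\boldsymbol{e},\boldsymbol{e}',\boldsymbol{s}')$, which is nowhere zero since $\Phi$ is skew; striction $\sigma$, the angle between $\boldsymbol{e}$ and $\boldsymbol{s}'$, and $\lambda:=\cot\sigma=\langle\boldsymbol{e},\boldsymbol{s}'\rangle/\delta$. Thus $\boldsymbol{s}'=\delta\lambda\,\boldsymbol{e}+\delta\,\boldsymbol{z}$. With $u^1=u$, $u^2=v$ and $w:=\sqrt{v^2+\delta^2}$, the fundamental forms (unit normal $(\boldsymbol{x}_u\times\boldsymbol{x}_v)/w$) are $g_{11}=v^2+\delta^2(\lambda^2+1)$, $g_{12}=\delta\lambda$, $g_{22}=1$, $h_{11}=-\frac1w\,[k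 v^2+\delta' v+\delta^2(k-\lambda)]$, $h_{12}=\frac{\delta}{w}$, $h_{22}=0$. The normal curvature in direction $du:dv$ is $k_N=\dfrac{h_{11}du^2+2h_{12}du\,dv+h_{22}dv^2}{g_{11}du^2+2g_{12}du\,dv+g_{22}dv^2}$; the normal curvature along a curve is that in its tangent direction. The orthogonal trajectories of the curves $v=\text{const}$ are determined by $[v^2+\delta^2(\lambda^2+1)]\,du+\delta\lambda\,dv=0$. Terminology. $\Phi$ is an Edlinger surface if all its osculating quadrics are hyperboloids of revolution; equivalently, $\delta'=0$ and $k\lambda+1=0$ identically on $I$. $\Phi$ is an orthoid if $\lambda=0$ identically on $I$. ''$f=0$'' means that $f$ vanishes identically on $I$. *)

(* Defs.v *)
From Stdlib Require Import Reals ZArith.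
From Coquelicot Require Import Coquelicot.
Open Scope R_scope.

(** Stdlib reals with Coquelicot.  Functions on an open interval I are total
    functions R -> R of which only the values on I matter; as I is open, the
    derivatives at points of I do not depend on the values outside I. *)

Definition in_I (a b : Rbar) (u : R) : Prop :=
  Rbar_lt a u /\ Rbar_lt u b.

(** * Vectors of R^3 *)

Notation V3 := (R * R * R)%type.

Definition c1 (p : V3) : R := fst (fst p).
Definition c2 (p : V3) : R := snd (fst p).
Definition c3 (p : V3) : R := snd p.

Definition dot (p q : V3) : R := c1 p * c1 q + c2 p * c2 q + c3 p * c3 q.

Definition cross (p q : V3) : V3 :=
  (c2 p * c3 q - c3 p * c2 q,
   c3 p * c1 q - c1 p * c3 q,
   c1 p * c2 q - c2 p * c1 q).

Definition triple (p q r : V3) : R := dot (cross p q) r.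

Definition norm3 (p : V3) : R := sqrt (dot p p).

Definition vderive (c : R -> V3) (u : R) : V3 :=
  (Derive (fun t => c1 (c t)) u,
   Derive (fun t => c2 (c t)) u,
   Derive (fun t => c3 (c t)) u).

(** * Parametrized surfaces *)

Fixpoint class_C (m : nat) (D : R -> R -> Prop) (g : R -> R -> R) : Prop :=
  (forall u v, D u v -> continuity_2d_pt g u v) /\
  match m with
  | O => True
  | S m' =>
      (forall u v, D u v ->
         ex_derive (fun t => g t v) u /\ ex_derive (fun t => g u t) v) /\
      class_C m' D (fun u v => Derive (fun t => g t v) u) /\
      class_C m' D (fun u v => Derive (fun t => g u t) v)
  end.

Definition class_C_V3 (m : nat) (D : R -> R -> Prop) (x : R -> R -> V3) : Prop :=
  class_C m D (fun u v => c1 (x u v)) /\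
  class_C m D (fun u v => c2 (x u v)) /\
  class_C m D (fun u v => c3 (x u v)).

Definition d_u (x : R -> R -> V3) (u v : R) : V3 := vderive (fun t => x t v) u.
Definition d_v (x : R -> R -> V3) (u v : R) : V3 := vderive (fun t => x u t) v.

Definition regular (D : R -> R -> Prop) (x : R -> R -> V3) : Prop :=
  forall u v, D u v -> cross (d_u x u v) (d_v x u v) <> (0, 0, 0).

Definition unit_normal (x : R -> R -> V3) (u v : R) : V3 :=
  let N := cross (d_u x u v) (d_v x u v) in scal (/ norm3 N) N.

Definition g11 (x : R -> R -> V3) (u v : R) : R := dot (d_u x u v) (d_u x u v).
Definition g12 (x : R -> R -> V3) (u v : R) : R := dot (d_u x u v) (d_v x u v).
Definition g22 (x : R -> R -> V3) (u v : R) : R := dot (d_v x u v) (d_v x u v).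

Definition h11 (x : R -> R -> V3) (u v : R) : R :=
  dot (d_u (d_u x) u v) (unit_normal x u v).
Definition h12 (x : R -> R -> V3) (u v : R) : R :=
  dot (d_v (d_u x) u v) (unit_normal x u v).
Definition h22 (x : R -> R -> V3) (u v : R) : R :=
  dot (d_v (d_v x) u v) (unit_normal x u v).

Definition normal_curvature (x : R -> R -> V3) (u v du dv : R) : R :=
  (h11 x u v * du ^ 2 + 2 * h12 x u v * du * dv + h22 x u v * dv ^ 2) /
  (g11 x u v * du ^ 2 + 2 * g12 x u v * du * dv + g22 x u v * dv ^ 2).

(** du : dv is the direction, at (u, v), of the orthogonal trajectory of the
    curves v = const: it is g-orthogonal to the direction 1 : 0. *)
Definition orthogonal_trajectory_direction
    (x : R -> R -> V3) (u v du dv : R) : Prop :=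
  (du, dv) <> (0, 0) /\ g11 x u v * du + g12 x u v * dv = 0.

(** * Ruled surfaces *)

Definition ruled (s e : R -> V3) (u v : R) : V3 := plus (s u) (scal v (e u)).

Definition conical_curvature (e : R -> V3) (u : R) : R :=
  triple (e u) (vderive e u) (vderive (vderive e) u).

Definition distribution_parameter (s e : R -> V3) (u : R) : R :=
  triple (e u) (vderive e u) (vderive s u).

(** The cotangent of the striction, the angle between e and s'. *)
Definition lambda (s e : R -> V3) (u : R) : R :=
  dot (e u) (vderive s u) / distribution_parameter s e u.

Definition striction_w (s e : R -> V3) (u v : R) : R :=
  sqrt (v ^ 2 + distribution_parameter s e u ^ 2).

Definition torsal (s e : R -> V3) (u : R) : Prop :=
  triple (e u) (vderive e u) (vderive s u) = 0.

Record skew_ruled_surface (a b : Rbar) (s e : R -> V3) : Prop := {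
  skew_C3 : class_C_V3 3 (fun u _ => in_I a b u) (ruled s e);
  skew_regular : regular (fun u _ => in_I a b u) (ruled s e);
  skew_no_torsal : forall u, in_I a b u -> ~ torsal s e u;
  skew_unit_generator : forall u, in_I a b u -> norm3 (e u) = 1;
  skew_striction_line :
    forall u, in_I a b u -> dot (vderive s u) (vderive e u) = 0;
  skew_arc_length : forall u, in_I a b u -> norm3 (vderive e u) = 1
}.

Definition orthoid (a b : Rbar) (s e : R -> V3) : Prop :=
  forall u, in_I a b u -> lambda s e u = 0.

(** * Osculating quadrics *)

Record quadric := {
  q11 : R; q22 : R; q33 : R; q12 : R; q13 : R; q23 : R;
  q1 : R; q2 : R; q3 : R; q0 : R;
  quadric_deg2 : (q11, q22, q33, q12, q13, q23) <> (0, 0, 0, 0, 0, 0)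
}.

Definition quadric_eval (Q : quadric) (p : V3) : R :=
  q11 Q * c1 p ^ 2 + q22 Q * c2 p ^ 2 + q33 Q * c3 p ^ 2
  + q12 Q * c1 p * c2 p + q13 Q * c1 p * c3 p + q23 Q * c2 p * c3 p
  + q1 Q * c1 p + q2 Q * c2 p + q3 Q * c3 p + q0 Q.

(** Q has contact of order two with the surface at every point of the
    generator u.  The left-hand side is quadratic in v, so these are nine
    linear conditions on the ten coefficients of Q; if the generator is not
    torsal, Q exists and is unique up to proportionality. *)
Definition osculating_quadric (s e : R -> V3) (u : R) (Q : quadric) : Prop :=
  forall (v : R) (i : nat), (i <= 2)%nat ->
    Derive_n (fun t => quadric_eval Q (ruled s e t v)) i u = 0.

(** With centre c, axis direction d, gorge radius r and conjugate semi-axis h.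
    Only the one-sheeted hyperboloid is relevant: the osculating quadric
    contains a straight line. *)
Definition hyperboloid_of_revolution (Q : quadric) : Prop :=
  exists (c d : V3) (r h : R),
    norm3 d = 1 /\ 0 < r /\ 0 < h /\
    forall p : V3,
      quadric_eval Q p = 0 <->
      (dot (minus p c) (minus p c) - dot (minus p c) d ^ 2) / r ^ 2
      - dot (minus p c) d ^ 2 / h ^ 2 = 1.

Definition Edlinger (a b : Rbar) (s e : R -> V3) : Prop :=
  forall u, in_I a b u ->
    forall Q, osculating_quadric s e u Q -> hyperboloid_of_revolution Q.

(* Main.v *)
From Stdlib Require Import Reals ZArith Lra Lia Classical Ranalysis5.
From Coquelicot Require Import Coquelicot.
Require Import Defs.
Open Scope R_scope.

(** The direction orthogonal to v = const is (- g12, g11).  With N = e',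
    Z = e x e' and the structure equations
      s' = delta lambda e + delta Z,   e'' = - e + k Z,
    the normal curvature in that direction is
      - delta^2 lambda P(v) / (w^3 g11),
      P(v) = (k lambda + 2) v^2 + lambda delta' v + delta^2 (k lambda + lambda^2 + 2),
    so the hypothesis says f w^(n+3) g11 = - delta^2 lambda P(v) for all v.

    Fix u.  If lambda(u) = 0 the right-hand side vanishes and f(u) = 0.  If
    lambda(u) <> 0, the left-hand side is even in v, whence delta'(u) = 0.  Put
    w = |delta| t: what remains is
      K t^(n+3) (t^2 + lambda^2) = (k lambda + 2) t^2 + lambda^2   for t >= 1,
    which forces n + 3 = 0 and k lambda = - 1
    ([power_times_quadratic], [normal_curvature_profile]).  Thus the continuous
    function k lambda takes only the values 0 and - 1, and by the intermediate
    value theorem it is constant ([continuous_two_values]): either lambda = 0 on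
    all of I, the orthoid, or k lambda = - 1 and delta' = 0 on all of I.

    In the second case the surface is an Edlinger surface.  Solving the linear
    conditions of second order contact in the frame (e, N, Z) based at s gives,
    up to a nonzero factor, the osculating quadric
      2 X Z - k Y^2 - (delta' / delta) Y Z - (lambda + k) Z^2 - 2 delta Y = 0
    ([osculating_quadric_frame_equation]).  If delta' = 0 and k lambda = - 1,
    multiplication by lambda makes the eigenvalues of the quadratic part
    1, 1, - lambda^2, so this is a hyperboloid of revolution
    ([osculating_quadric_of_revolution]).

    Throughout, delta' enters as the product of s'' with Z.  The two agree since
    Z' = - k N is orthogonal to s', but in this form every formula at u uses
    only the derivatives of s and e at u. *)

(** * The orthonormal frame along a generator *)

Lemma V3_ext (p q : V3) : c1 p = c1 q -> c2 p = c2 q -> c3 p = c3 q -> p = q.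
Proof.
  destruct p as [[p1 p2] p3], q as [[r1 r2] r3]; unfold c1, c2, c3; simpl.
  now intros -> -> ->.
Qed.

Lemma norm3_unit (p : V3) : norm3 p = 1 -> dot p p = 1.
Proof.
  unfold norm3; intros H.
  rewrite <- (sqrt_sqrt (dot p p)), H; [ring|].
  unfold dot; nra.
Qed.

Lemma dot_comm (p q : V3) : dot p q = dot q p.
Proof. unfold dot; ring. Qed.

Lemma dot_zero p : dot (0, 0, 0) p = 0.
Proof. unfold dot, c1, c2, c3; simpl; ring. Qed.

Definition orthonormal (E N : V3) : Prop :=
  dot E E = 1 /\ dot N N = 1 /\ dot E N = 0.

Definition comb (E N : V3) (X Y Z : R) : V3 :=
  plus (plus (scal X E) (scal Y N)) (scal Z (cross E N)).

Lemma c1_plus p r : c1 (plus p r) = c1 p + c1 r. Proof. reflexivity. Qed.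
Lemma c2_plus p r : c2 (plus p r) = c2 p + c2 r. Proof. reflexivity. Qed.
Lemma c3_plus p r : c3 (plus p r) = c3 p + c3 r. Proof. reflexivity. Qed.
Lemma c1_minus p r : c1 (minus p r) = c1 p - c1 r. Proof. reflexivity. Qed.
Lemma c2_minus p r : c2 (minus p r) = c2 p - c2 r. Proof. reflexivity. Qed.
Lemma c3_minus p r : c3 (minus p r) = c3 p - c3 r. Proof. reflexivity. Qed.
Lemma c1_scal x p : c1 (scal x p) = x * c1 p. Proof. reflexivity. Qed.
Lemma c2_scal x p : c2 (scal x p) = x * c2 p. Proof. reflexivity. Qed.
Lemma c3_scal x p : c3 (scal x p) = x * c3 p. Proof. reflexivity. Qed.

Lemma c1_cross p r : c1 (cross p r) = c2 p * c3 r - c3 p * c2 r.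
Proof. reflexivity. Qed.
Lemma c2_cross p r : c2 (cross p r) = c3 p * c1 r - c1 p * c3 r.
Proof. reflexivity. Qed.
Lemma c3_cross p r : c3 (cross p r) = c1 p * c2 r - c2 p * c1 r.
Proof. reflexivity. Qed.

Lemma c1_comb E N X Y Z :
  c1 (comb E N X Y Z) = X * c1 E + Y * c1 N + Z * c1 (cross E N).
Proof. reflexivity. Qed.
Lemma c2_comb E N X Y Z :
  c2 (comb E N X Y Z) = X * c2 E + Y * c2 N + Z * c2 (cross E N).
Proof. reflexivity. Qed.
Lemma c3_comb E N X Y Z :
  c3 (comb E N X Y Z) = X * c3 E + Y * c3 N + Z * c3 (cross E N).
Proof. reflexivity. Qed.

Ltac V3_coordinates :=
  rewrite ?c1_minus, ?c2_minus, ?c3_minus, ?c1_plus, ?c2_plus, ?c3_plus,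
    ?c1_scal, ?c2_scal, ?c3_scal, ?c1_comb, ?c2_comb, ?c3_comb.

Lemma plus_scal_comb E N X Y Z X' Y' Z' v :
  plus (comb E N X Y Z) (scal v (comb E N X' Y' Z')) =
  comb E N (X + v * X') (Y + v * Y') (Z + v * Z').
Proof. apply V3_ext; V3_coordinates; ring. Qed.

Lemma scal_comb E N X Y Z r : scal r (comb E N X Y Z) = comb E N (r * X) (r * Y) (r * Z).
Proof. apply V3_ext; V3_coordinates; ring. Qed.

Lemma comb_E E N : E = comb E N 1 0 0.
Proof. apply V3_ext; V3_coordinates; ring. Qed.

Lemma comb_N E N : N = comb E N 0 1 0.
Proof. apply V3_ext; V3_coordinates; ring. Qed.

Lemma dot_cross_self E N : dot (cross E N) (cross E N) = dot E E * dot N N - dot E N ^ 2.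
Proof. unfold dot, cross, c1, c2, c3; simpl; ring. Qed.

(** By Cramer's rule, |E x N|^2 P is the combination of N x (E x N),
    (E x N) x E and E x N whose coefficients are the products of P with E, N
    and E x N; the first two of these vectors are E and N again. *)
Lemma comb_coordinates E N P :
  orthonormal E N -> P = comb E N (dot P E) (dot P N) (dot P (cross E N)).
Proof.
  intros (HE & HN & HEN).
  assert (HZ := dot_cross_self E N); rewrite HE, HN, HEN in HZ.
  assert (F : forall c : V3 -> R,
    dot (cross E N) (cross E N) * c P =
      dot P E * (dot N N * c E - dot E N * c N)
      + dot P N * (dot E E * c N - dot E N * c E)
      + dot P (cross E N) * c (cross E N) ->
    c P = dot P E * c E + dot P N * c N + dot P (cross E N) * c (cross E N)).
  { intros c Hc; rewrite HZ, HE, HN, HEN in Hc; lra. }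
  apply V3_ext; V3_coordinates; apply F; unfold dot, cross, c1, c2, c3; simpl; ring.
Qed.

Lemma dot_comb E N X Y Z X' Y' Z' :
  orthonormal E N ->
  dot (comb E N X Y Z) (comb E N X' Y' Z') = X * X' + Y * Y' + Z * Z'.
Proof.
  intros (HE & HN & HEN).
  transitivity (X * X' * dot E E + Y * Y' * dot N N + (X * Y' + Y * X') * dot E N
    + Z * Z' * dot (cross E N) (cross E N)).
  - unfold dot; V3_coordinates; unfold cross, c1, c2, c3; simpl; ring.
  - rewrite dot_cross_self, HE, HN, HEN; ring.
Qed.

Lemma dot_comb_E E N X Y Z : orthonormal E N -> dot (comb E N X Y Z) E = X.
Proof.
  intros O; pose proof (dot_comb E N X Y Z 1 0 0 O) as H.
  rewrite <- comb_E in H; rewrite H; ring.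
Qed.

Lemma dot_comb_N E N X Y Z : orthonormal E N -> dot (comb E N X Y Z) N = Y.
Proof.
  intros O; pose proof (dot_comb E N X Y Z 0 1 0 O) as H.
  rewrite <- comb_N in H; rewrite H; ring.
Qed.

Lemma cross_comb E N X Y Z :
  orthonormal E N -> cross (comb E N X Y Z) E = comb E N 0 Z (- Y).
Proof.
  intros (HE & HN & HEN).
  (* (E x N) x E = (E.E) N - (E.N) E *)
  transitivity (comb E N (- Z * dot E N) (Z * dot E E) (- Y)).
  - apply V3_ext; V3_coordinates; rewrite ?c1_cross, ?c2_cross, ?c3_cross;
      V3_coordinates; rewrite ?c1_cross, ?c2_cross, ?c3_cross; unfold dot; ring.
  - rewrite HE, HEN; f_equal; ring.
Qed.

(** * Differentiation of the surface and of its frame *)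

Lemma in_I_open a b u : in_I a b u -> locally u (in_I a b).
Proof. intros [H1 H2]; apply filter_and; [now apply open_Rbar_gt|now apply open_Rbar_lt]. Qed.

Lemma locally_in_I a b u (P : R -> Prop) :
  in_I a b u -> (forall t, in_I a b t -> P t) -> locally u P.
Proof. intros Hu HP; exact (filter_imp _ _ HP (in_I_open a b u Hu)). Qed.

Lemma class_C_Derive_n m j D g :
  class_C (j + m) D g -> class_C m D (fun u v => Derive_n (fun t => g t v) j u).
Proof.
  revert m; induction j as [|j IH]; intros m H; [exact H|].
  replace (S j + m)%nat with (j + S m)%nat in H by lia.
  now destruct (IH _ H) as (_ & _ & H' & _).
Qed.

(** Smoothness of x on the surface passes to s = x(., 0) and to
    e = x(., 1) - x(., 0). *)
Lemma class_C3_ruled_component a b (p q : R -> R) :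
  class_C 3 (fun u _ => in_I a b u) (fun u v => p u + v * q u) ->
  forall u j, (j <= 3)%nat -> in_I a b u -> ex_derive_n p j u /\ ex_derive_n q j u.
Proof.
  intros H.
  assert (G : forall v u j, (j <= 3)%nat -> in_I a b u ->
            ex_derive_n (fun t => p t + v * q t) j u).
  { intros v u [|j] Hj Hu; [exact I|].
    replace 3%nat with (j + S (2 - j))%nat in H by lia.
    destruct (class_C_Derive_n _ _ _ _ H) as (_ & H' & _).
    exact (proj1 (H' u v Hu)). }
  intros u j Hj Hu; split.
  - apply ex_derive_n_ext with (fun t => p t + 0 * q t); [intros t; ring|now apply G].
  - apply ex_derive_n_ext with (fun t => (p t + 1 * q t) - (p t + 0 * q t)); [intros t; ring|].
    apply (ex_derive_n_minus (fun t => p t + 1 * q t) (fun t => p t + 0 * q t));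
      generalize (in_I_open a b u Hu); apply filter_imp; intros t Ht i Hi; apply G; trivial; lia.
Qed.

(** [vderive] is total, so its value carries information only together with
    differentiability of the three coordinates, which this relation includes. *)
Definition is_vderive (c : R -> V3) (u : R) (l : V3) : Prop :=
  is_derive (fun t => c1 (c t)) u (c1 l) /\
  is_derive (fun t => c2 (c t)) u (c2 l) /\
  is_derive (fun t => c3 (c t)) u (c3 l).

Lemma is_vderive_unique c u l : is_vderive c u l -> vderive c u = l.
Proof.
  intros (H1 & H2 & H3).
  apply V3_ext; unfold vderive; simpl; now apply is_derive_unique.
Qed.

Lemma is_vderive_ext_loc c d u l :
  locally u (fun t => c t = d t) -> is_vderive c u l -> is_vderive d u l.
Proof.
  intros Heq (H1 & H2 & H3); split; [|split];
    (eapply is_derive_ext_loc; [|eassumption]);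
    (eapply filter_imp; [|exact Heq]); intros t Ht; simpl; now rewrite Ht.
Qed.

Lemma is_vderive_ruled s e u v S E :
  is_vderive s u S -> is_vderive e u E ->
  is_vderive (fun t => ruled s e t v) u (plus S (scal v E)).
Proof.
  intros (H1 & H2 & H3) (K1 & K2 & K3); split; [|split];
    [exact (is_derive_plus _ _ u _ _ H1 (is_derive_scal _ u v _ K1))
    |exact (is_derive_plus _ _ u _ _ H2 (is_derive_scal _ u v _ K2))
    |exact (is_derive_plus _ _ u _ _ H3 (is_derive_scal _ u v _ K3))].
Qed.

Lemma is_derive_dot c d u C D :
  is_vderive c u C -> is_vderive d u D ->
  is_derive (fun t => dot (c t) (d t)) u (dot C (d u) + dot (c u) D).
Proof.
  intros (H1 & H2 & H3) (K1 & K2 & K3).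
  assert (M : forall f g l m, is_derive f u l -> is_derive g u m ->
            is_derive (fun t => f t * g t) u (l * g u + f u * m))
    by (intros f g l m Hf Hg; exact (is_derive_mult f g u l m Hf Hg Rmult_comm)).
  replace (dot C (d u) + dot (c u) D) with
    (c1 C * c1 (d u) + c1 (c u) * c1 D + (c2 C * c2 (d u) + c2 (c u) * c2 D)
     + (c3 C * c3 (d u) + c3 (c u) * c3 D)) by (unfold dot; ring).
  exact (is_derive_plus _ _ u _ _
    (is_derive_plus _ _ u _ _ (M _ _ _ _ H1 K1) (M _ _ _ _ H2 K2)) (M _ _ _ _ H3 K3)).
Qed.

Lemma is_vderive_line P D v : is_vderive (fun t => plus P (scal t D)) v D.
Proof.
  split; [|split]; [apply (is_derive_ext (fun t => c1 P + t * c1 D))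
                |apply (is_derive_ext (fun t => c2 P + t * c2 D))
                |apply (is_derive_ext (fun t => c3 P + t * c3 D))];
    (reflexivity || (auto_derive; [trivial|ring])).
Qed.

Lemma is_vderive_const P v : is_vderive (fun _ => P) v (0, 0, 0).
Proof.
  split; [|split]; simpl; apply @is_derive_const.
Qed.

Lemma is_vderive_vderive c u :
  ex_derive (fun t => c1 (c t)) u -> ex_derive (fun t => c2 (c t)) u ->
  ex_derive (fun t => c3 (c t)) u -> is_vderive c u (vderive c u).
Proof. intros H1 H2 H3; split; [|split]; now apply Derive_correct. Qed.

Lemma skew_vderive a b s e u :
  skew_ruled_surface a b s e -> in_I a b u ->
  (is_vderive s u (vderive s u) /\
   is_vderive (vderive s) u (vderive (vderive s) u)) /\
  is_vderive e u (vderive e u) /\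
  is_vderive (vderive e) u (vderive (vderive e) u) /\
  is_vderive (vderive (vderive e)) u (vderive (vderive (vderive e)) u).
Proof.
  intros [(H1 & H2 & H3) _ _ _ _ _] Hu.
  pose proof (fun j Hj => class_C3_ruled_component a b _ _ H1 u j Hj Hu) as K1.
  pose proof (fun j Hj => class_C3_ruled_component a b _ _ H2 u j Hj Hu) as K2.
  pose proof (fun j Hj => class_C3_ruled_component a b _ _ H3 u j Hj Hu) as K3.
  assert (L1 : (1 <= 3)%nat) by lia.
  assert (L2 : (2 <= 3)%nat) by lia.
  assert (L3 : (3 <= 3)%nat) by lia.
  split; [split|split; [|split]]; apply is_vderive_vderive.
  - exact (proj1 (K1 1%nat L1)).
  - exact (proj1 (K2 1%nat L1)).
  - exact (proj1 (K3 1%nat L1)).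
  - exact (proj1 (K1 2%nat L2)).
  - exact (proj1 (K2 2%nat L2)).
  - exact (proj1 (K3 2%nat L2)).
  - exact (proj2 (K1 1%nat L1)).
  - exact (proj2 (K2 1%nat L1)).
  - exact (proj2 (K3 1%nat L1)).
  - exact (proj2 (K1 2%nat L2)).
  - exact (proj2 (K2 2%nat L2)).
  - exact (proj2 (K3 2%nat L2)).
  - exact (proj2 (K1 3%nat L3)).
  - exact (proj2 (K2 3%nat L3)).
  - exact (proj2 (K3 3%nat L3)).
Qed.

Lemma skew_orthonormal a b s e u :
  skew_ruled_surface a b s e -> in_I a b u -> orthonormal (e u) (vderive e u).
Proof.
  intros H Hu.
  assert (HE := fun t Ht => norm3_unit _ (skew_unit_generator _ _ _ _ H t Ht)).
  repeat split; [now apply HE|apply norm3_unit; now apply (skew_arc_length _ _ _ _ H)|].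
  destruct (skew_vderive _ _ _ _ _ H Hu) as (_ & D & _).
  assert (K := is_derive_unique _ _ _ (is_derive_dot _ _ _ _ _ D D)).
  rewrite (Derive_ext_loc _ (fun _ => 1)), Derive_const in K.
  - rewrite (dot_comm (vderive e u)) in K; lra.
  - apply (locally_in_I a b _ _ Hu); intros t Ht; now apply HE.
Qed.

(** Differentiating |e|^2 = 1, |e'|^2 = 1 and s'.e' = 0 leaves as free
    coordinates only delta, lambda, k and the e- and Z-components of s''; in
    particular s''.N = - s'.e''. *)
Lemma skew_frame_equations a b s e u :
  skew_ruled_surface a b s e -> in_I a b u ->
  let E := e u in let N := vderive e u in
  let k := conical_curvature e u in
  let d := distribution_parameter s e u in let l := lambda s e u in
  let S2 := vderive (vderive s) u in
  vderive s u = comb E N (d * l) 0 d /\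
  vderive (vderive e) u = comb E N (- 1) 0 k /\
  S2 = comb E N (dot S2 E) (d * (l - k)) (dot S2 (cross E N)).
Proof.
  intros H Hu E N k d l S2.
  destruct (skew_vderive _ _ _ _ _ H Hu) as ((DS & DS2) & DE & DE2 & _).
  assert (O := skew_orthonormal _ _ _ _ _ H Hu).
  assert (Hd : d <> 0) by exact (skew_no_torsal _ _ _ _ H u Hu).
  assert (HS : vderive s u = comb E N (d * l) 0 d).
  { rewrite (comb_coordinates _ _ (vderive s u) O) at 1; fold E N.
    assert (HSN : dot (vderive s u) N = 0) by exact (skew_striction_line _ _ _ _ H u Hu).
    rewrite HSN.
    rewrite (dot_comm _ (cross E N)), (dot_comm _ E).
    f_equal; unfold l, lambda; fold d E; field; exact Hd. }
  assert (E2E : dot (vderive (vderive e) u) E = - 1).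
  { assert (K := is_derive_unique _ _ _ (is_derive_dot _ _ _ _ _ DE DE2)).
    rewrite (Derive_ext_loc _ (fun _ => 0)), Derive_const in K.
    - destruct O as (_ & ON & _); fold E N in ON, K; rewrite (dot_comm E), ON in K; lra.
    - apply (locally_in_I a b _ _ Hu); intros t Ht.
      apply (skew_orthonormal _ _ _ _ _ H Ht). }
  assert (E2N : dot (vderive (vderive e) u) N = 0).
  { assert (K := is_derive_unique _ _ _ (is_derive_dot _ _ _ _ _ DE2 DE2)).
    rewrite (Derive_ext_loc _ (fun _ => 1)), Derive_const in K.
    - rewrite (dot_comm (vderive e u)) in K; fold N in K; lra.
    - apply (locally_in_I a b _ _ Hu); intros t Ht.
      apply (skew_orthonormal _ _ _ _ _ H Ht). }
  assert (HE2 : vderive (vderive e) u = comb E N (- 1) 0 k).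
  { rewrite (comb_coordinates _ _ (vderive (vderive e) u) O) at 1; fold E N.
    now rewrite E2E, E2N, (dot_comm _ (cross E N)). }
  split; [exact HS|split; [exact HE2|]].
  rewrite (comb_coordinates _ _ S2 O) at 1; fold E N; f_equal.
  assert (K := is_derive_unique _ _ _ (is_derive_dot _ _ _ _ _ DS2 DE2)).
  rewrite (Derive_ext_loc _ (fun _ => 0)), Derive_const in K.
  - fold S2 N in K; rewrite HS, HE2, (dot_comb _ _ _ _ _ _ _ _ O) in K; lra.
  - apply (locally_in_I a b _ _ Hu); intros t Ht.
    apply (skew_striction_line _ _ _ _ H t Ht).
Qed.

(** * The normal curvature along the orthogonal trajectories *)

Lemma ruled_partials a b s e u v :
  skew_ruled_surface a b s e -> in_I a b u ->
  d_u (ruled s e) u v = plus (vderive s u) (scal v (vderive e u)) /\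
   d_v (ruled s e) u v = e u /\
  d_u (d_u (ruled s e)) u v =
    plus (vderive (vderive s) u) (scal v (vderive (vderive e) u)) /\
   d_v (d_u (ruled s e)) u v = vderive e u /\
  d_v (d_v (ruled s e)) u v = (0, 0, 0).
Proof.
  intros H Hu.
  assert (Du : forall t r, in_I a b t ->
    d_u (ruled s e) t r = plus (vderive s t) (scal r (vderive e t))).
  { intros t r Ht; apply is_vderive_unique.
    destruct (skew_vderive _ _ _ _ _ H Ht) as ((DS & _) & DE & _).
    now apply is_vderive_ruled. }
  assert (Dv : forall r, d_v (ruled s e) u r = e u)
    by (intros r; apply is_vderive_unique; apply is_vderive_line).
  destruct (skew_vderive _ _ _ _ _ H Hu) as ((_ & DS2) & _ & DE2 & _).
  repeat split; [now apply Du|apply Dv|apply is_vderive_unique..].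
  - eapply is_vderive_ext_loc; [|apply (is_vderive_ruled _ _ _ v _ _ DS2 DE2)].
    apply (locally_in_I a b _ _ Hu); intros t Ht; symmetry; now apply Du.
  - eapply is_vderive_ext_loc; [|apply (is_vderive_line (vderive s u) (vderive e u) v)].
    apply filter_forall; intros t; symmetry; now apply Du.
  - eapply is_vderive_ext_loc; [|apply (is_vderive_const (e u) v)].
    apply filter_forall; intros t; symmetry; apply Dv.
Qed.

Lemma skew_fundamental_forms a b s e u v :
  skew_ruled_surface a b s e -> in_I a b u ->
  let k := conical_curvature e u in
  let d := distribution_parameter s e u in let l := lambda s e u in
  let p := dot (vderive (vderive s) u) (cross (e u) (vderive e u)) in
  let w := striction_w s e u v in
  (g11 (ruled s e) u v = v ^ 2 + d ^ 2 * (l ^ 2 + 1) /\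
   g12 (ruled s e) u v = d * l /\ g22 (ruled s e) u v = 1) /\
  h11 (ruled s e) u v = - / w * (k * v ^ 2 + p * v + d ^ 2 * (k - l)) /\
  h12 (ruled s e) u v = d / w /\ h22 (ruled s e) u v = 0.
Proof.
  intros H Hu k d l p w.
  assert (O := skew_orthonormal _ _ _ _ _ H Hu).
  destruct (skew_frame_equations _ _ _ _ _ H Hu) as (HS & HE2 & HS2).
  destruct (ruled_partials _ _ _ _ _ v H Hu) as (Du & Dv & Duu & Duv & Dvv).
  fold k d l p in HS, HE2, HS2.
  set (q := dot (vderive (vderive s) u) (e u)) in HS2.
  set (E := e u) in *; set (N := vderive e u) in *.
  replace (plus (vderive s u) (scal v N)) with (comb E N (d * l) v d) in Du.
  2: { transitivity (plus (comb E N (d * l) 0 d) (scal v (comb E N 0 1 0))).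
       - rewrite plus_scal_comb; f_equal; ring.
       - now rewrite <- comb_N, HS. }
  rewrite HS2, HE2, plus_scal_comb in Duu.
  assert (HU : unit_normal (ruled s e) u v = comb E N 0 (/ w * d) (/ w * - v)).
  { unfold unit_normal; rewrite Du, Dv, cross_comb, scal_comb by exact O.
    unfold norm3; rewrite dot_comb by exact O.
    replace (0 * 0 + d * d + - v * - v) with (v ^ 2 + d ^ 2) by ring.
    fold (striction_w s e u v); fold w; f_equal; ring. }
  unfold g11, g12, g22, h11, h12, h22; rewrite HU, Du, Dv, Duu, Duv, Dvv, dot_zero.
  rewrite (dot_comm N), !dot_comb, dot_comb_E, dot_comb_N by exact O.
  destruct O as (OE & _); rewrite OE.
  repeat split; (reflexivity || unfold Rdiv; ring).
Qed.

Lemma striction_w_pos s e u v :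
  distribution_parameter s e u <> 0 -> 0 < striction_w s e u v.
Proof.
  intros Hd; apply sqrt_lt_R0.
  assert (0 < distribution_parameter s e u ^ 2) by now apply pow2_gt_0.
  pose proof (pow2_ge_0 v); lra.
Qed.

Lemma striction_w_sqr s e u v :
  striction_w s e u v ^ 2 = v ^ 2 + distribution_parameter s e u ^ 2.
Proof.
  unfold striction_w; rewrite <- Rsqr_pow2; apply Rsqr_sqrt.
  pose proof (pow2_ge_0 v); pose proof (pow2_ge_0 (distribution_parameter s e u)); lra.
Qed.

(** The first fundamental form of (- g12, g11) is g11 (g11 g22 - g12^2) = g11 w^2.
    The denominators are cleared so that the identity is polynomial in v, up to
    the powers of w. *)
Lemma normal_curvature_orthogonal_trajectory a b s e u v du dv :
  skew_ruled_surface a b s e -> in_I a b u ->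
  let k := conical_curvature e u in
  let d := distribution_parameter s e u in let l := lambda s e u in
  let p := dot (vderive (vderive s) u) (cross (e u) (vderive e u)) in
  let w := striction_w s e u v in
  du = - g12 (ruled s e) u v -> dv = g11 (ruled s e) u v ->
  orthogonal_trajectory_direction (ruled s e) u v du dv /\
  normal_curvature (ruled s e) u v du dv * (w ^ 3 * (v ^ 2 + d ^ 2 * (l ^ 2 + 1))) =
  - d ^ 2 * l * ((l * k + 2) * v ^ 2 + l * p * v + d ^ 2 * (l * k + l ^ 2 + 2)).
Proof.
  intros H Hu k d l p w -> ->.
  assert (Hd : d <> 0) by exact (skew_no_torsal _ _ _ _ H u Hu).
  assert (Hw : 0 < w) by now apply striction_w_pos.
  assert (Hw2 : w ^ 2 = v ^ 2 + d ^ 2) by apply striction_w_sqr.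
  unfold orthogonal_trajectory_direction, normal_curvature.
  destruct (skew_fundamental_forms _ _ _ _ u v H Hu) as ((-> & G12 & G22) & H11 & H12 & H22).
  fold k d l p w in G12, G22, H11, H12, H22 |- *.
  assert (HG : 0 < v ^ 2 + d ^ 2 * (l ^ 2 + 1)) by nra.
  rewrite G12, G22, H11, H12, H22; split; [split|].
  - intros K; injection K; intros K' _; lra.
  - ring.
  - replace ((v ^ 2 + d ^ 2 * (l ^ 2 + 1)) * (- (d * l)) ^ 2 +
      2 * (d * l) * - (d * l) * (v ^ 2 + d ^ 2 * (l ^ 2 + 1)) +
      1 * (v ^ 2 + d ^ 2 * (l ^ 2 + 1)) ^ 2)
      with ((v ^ 2 + d ^ 2 * (l ^ 2 + 1)) * w ^ 2) by (rewrite Hw2; ring).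
    field; split; lra.
Qed.

(** * Comparing the dependence on v *)

Lemma powerRZ_eq_1 x m : 1 < x -> powerRZ x m = 1 -> m = 0%Z.
Proof.
  intros Hx H.
  assert (P : forall q : positive, 1 < x ^ Pos.to_nat q)
    by (intros q; apply Rlt_pow_R1; [exact Hx|apply Pos2Nat.is_pos]).
  destruct m as [|q|q]; [reflexivity| |]; simpl in H; specialize (P q); [lra|].
  assert (x ^ Pos.to_nat q = 1) by (rewrite <- (Rinv_inv (x ^ _)), H; lra).
  lra.
Qed.

(** At t = 2^j both sides are sums of exponentials in j: with x = 2^m the left
    one has the ratios 4x and x, the right one 4 and 1.  The recurrence
    annihilating 4^j and 1^j, applied to the values for j = 0, 1, 2, 3, must
    therefore kill the left side, which leaves only x = 1. *)
Lemma power_times_quadratic K c A m :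
  0 < c ->
  (forall t, 1 <= t -> K * powerRZ t m * (t ^ 2 + c) = A * t ^ 2 + c) ->
  m = 0%Z /\ K = 1 /\ A = 1.
Proof.
  intros Hc H.
  pose (x := powerRZ 2 m).
  assert (X4 : powerRZ 4 m = x ^ 2).
  { unfold x; simpl; rewrite Rmult_1_r, <- powerRZ_mult; f_equal; ring. }
  assert (X8 : powerRZ 8 m = x ^ 3).
  { unfold x; simpl; rewrite Rmult_1_r, <- !powerRZ_mult; f_equal; ring. }
  assert (H1 := H 1 ltac:(lra)); rewrite powerRZ_R1 in H1.
  assert (H2 := H 2 ltac:(lra)); fold x in H2.
  assert (H4 := H 4 ltac:(lra)); rewrite X4 in H4.
  assert (H8 := H 8 ltac:(lra)); rewrite X8 in H8.
  assert (HK : K <> 0) by (intros ->; lra).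
  assert (Hx : 0 < x) by (apply powerRZ_lt; lra).
  (* a_(j+2) - 5 a_(j+1) + 4 a_j = 0 for j = 0 and j = 1 *)
  assert (E0 : K * (x - 1) * (4 * (4 * x - 1) + (x - 4) * c) = 0) by lra.
  assert (E1 : K * (x - 1) * x * (16 * (4 * x - 1) + (x - 4) * c) = 0) by lra.
  assert (Hx1 : x = 1).
  { destruct (Req_dec x 1) as [|N]; [assumption|exfalso].
    assert (N' : x - 1 <> 0) by lra.
    assert (F0 : 4 * (4 * x - 1) + (x - 4) * c = 0).
    { apply Rmult_integral in E0 as [E0|E0]; [|exact E0].
      apply Rmult_integral in E0; tauto. }
    assert (F1 : 16 * (4 * x - 1) + (x - 4) * c = 0).
    { apply Rmult_integral in E1 as [E1|E1]; [|exact E1].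
      apply Rmult_integral in E1 as [E1|E1]; [|lra].
      apply Rmult_integral in E1; tauto. }
    assert (x = / 4) by lra.
    nra. }
  rewrite Hx1 in H2.
  split; [apply (powerRZ_eq_1 2); [lra|exact Hx1]|].
  assert (K = A) by lra; subst A.
  split; nra.
Qed.

(** The odd part in v gives p = 0; the even part, in the variable
    t = w / |d|, is the situation of [power_times_quadratic] with c = l^2. *)
Lemma normal_curvature_profile f n d l k p :
  d <> 0 ->
  (forall v, f * powerRZ (sqrt (v ^ 2 + d ^ 2)) n *
     (sqrt (v ^ 2 + d ^ 2) ^ 3 * (v ^ 2 + d ^ 2 * (l ^ 2 + 1))) =
     - d ^ 2 * l * ((l * k + 2) * v ^ 2 + l * p * v + d ^ 2 * (l * k + l ^ 2 + 2))) ->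
  f = - d ^ 2 * l /\ (l <> 0 -> n = (- 3)%Z /\ p = 0 /\ k * l = - 1).
Proof.
  intros Hd H.
  assert (Hd2 : 0 < d ^ 2) by (apply pow2_gt_0; exact Hd).
  assert (Ha : 0 < Rabs d) by (apply Rabs_pos_lt; exact Hd).
  assert (Ha2 : Rabs d ^ 2 = d ^ 2) by apply pow2_abs.
  assert (Hw : forall v, 0 < sqrt (v ^ 2 + d ^ 2))
    by (intros v; apply sqrt_lt_R0; pose proof (pow2_ge_0 v); lra).
  destruct (Req_dec l 0) as [Hl|Hl].
  - split; [|tauto].
    specialize (H 0); specialize (Hw 0).
    rewrite Hl in H |- *.
    assert (P := powerRZ_lt _ n Hw); assert (P3 := pow_lt _ 3 Hw).
    assert (Z : f * (powerRZ (sqrt (0 ^ 2 + d ^ 2)) n * sqrt (0 ^ 2 + d ^ 2) ^ 3 * d ^ 2) = 0)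
      by lra.
    apply Rmult_integral in Z as [Z|Z]; [lra|].
    exfalso; revert Z; apply Rgt_not_eq; apply Rmult_lt_0_compat; [apply Rmult_lt_0_compat|]; assumption.
  - assert (Hl2 : 0 < l ^ 2) by (apply pow2_gt_0; exact Hl).
    assert (Hdl : - d ^ 2 * l <> 0) by (apply Rmult_integral_contrapositive; split; lra).
    assert (Hp : p = 0).
    (* the left-hand sides agree at v = 1 and v = - 1 *)
    { assert (P1 := H 1); assert (P2 := H (- 1)).
      replace ((- 1) ^ 2) with (1 ^ 2) in P2 by ring.
      rewrite P1 in P2.
      assert (Z : - d ^ 2 * l * (l * p) = 0) by lra.
      apply Rmult_integral in Z as [Z|Z]; [tauto|].
      apply Rmult_integral in Z; tauto. }
    destruct (power_times_quadratic
      (f * powerRZ (Rabs d) (n + 3) / (- d ^ 2 * l)) (l ^ 2) (l * k + 2) (n + 3) Hl2)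
      as (Hm & HK & HA).
    { intros t Ht.
      pose (v := Rabs d * sqrt (t ^ 2 - 1)).
      assert (Hv : v ^ 2 = d ^ 2 * (t ^ 2 - 1)).
      { unfold v; rewrite Rpow_mult_distr, Ha2, pow2_sqrt; [reflexivity|nra]. }
      assert (Hwt : sqrt (v ^ 2 + d ^ 2) = Rabs d * t).
      { rewrite Hv; replace (d ^ 2 * (t ^ 2 - 1) + d ^ 2) with ((Rabs d * t) ^ 2)
          by (rewrite Rpow_mult_distr, Ha2; ring).
        apply sqrt_pow2; nra. }
      specialize (H v); rewrite Hwt, Hv, Hp in H.
      assert (Hpow : powerRZ (Rabs d) (n + 3) * powerRZ t (n + 3) =
                     powerRZ (Rabs d * t) n * (Rabs d * t) ^ 3).
      { rewrite <- powerRZ_mult, powerRZ_add by nra; reflexivity. }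
      apply (Rmult_eq_reg_l ((- d ^ 2 * l) * d ^ 2)); [|nra].
      transitivity (f * (powerRZ (Rabs d) (n + 3) * powerRZ t (n + 3)) * (d ^ 2 * (t ^ 2 + l ^ 2)));
        [field; split; assumption|].
      rewrite Hpow; lra. }
    rewrite Hm in HK; change (powerRZ _ 0) with 1 in HK.
    split.
    + transitivity (f * 1 / (- d ^ 2 * l) * (- d ^ 2 * l)); [field; split; assumption|].
      rewrite HK; ring.
    + intros _; split; [lia|split; [exact Hp|lra]].
Qed.

(** The consequences of the hypothesis at a single u; the Z-component of s'' is
    the derivative of the distribution parameter. *)
Lemma normal_curvature_hypothesis_pointwise a b s e (n : Z) f u :
  skew_ruled_surface a b s e -> in_I a b u ->
  (forall v du dv,
     orthogonal_trajectory_direction (ruled s e) u v du dv ->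
     normal_curvature (ruled s e) u v du dv = f * powerRZ (striction_w s e u v) n) ->
  f = - distribution_parameter s e u ^ 2 * lambda s e u /\
  (lambda s e u <> 0 ->
   n = (- 3)%Z /\
   dot (vderive (vderive s) u) (cross (e u) (vderive e u)) = 0 /\
   conical_curvature e u * lambda s e u = - 1).
Proof.
  intros H Hu Hk.
  apply (normal_curvature_profile _ n); [exact (skew_no_torsal _ _ _ _ H u Hu)|].
  intros v.
  destruct (normal_curvature_orthogonal_trajectory _ _ _ _ u v _ _ H Hu eq_refl eq_refl)
    as (Hdir & Hcurv).
  now rewrite (Hk _ _ _ Hdir) in Hcurv.
Qed.

(** * Propagation along the base interval *)

(** A change of value between u and t would force the midpoint (y + z) / 2 to be
    attained in between. *)
Lemma continuous_two_values (g : R -> R) a b (y z : R) :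
  y < z ->
  (forall u, in_I a b u -> continuous g u) ->
  (forall u, in_I a b u -> g u = y \/ g u = z) ->
  forall u t, in_I a b u -> in_I a b t -> g u = g t.
Proof.
  intros Hyz Hc Hv.
  assert (K : forall u t, u < t -> in_I a b u -> in_I a b t -> g u = g t).
  { intros u t Hut Hu Ht.
    assert (Hin : forall r, u <= r <= t -> in_I a b r).
    { intros r Hr; split.
      - apply Rbar_lt_le_trans with u; [apply Hu|apply Hr].
      - apply Rbar_le_lt_trans with t; [apply Hr|apply Ht]. }
    assert (Hcont : forall (c m : R) r, u <= r <= t ->
              continuity_pt (fun x => c * (g x - m)) r).
    { intros c m r Hr; apply continuity_pt_filterlim.
      apply (continuous_scal_r c (fun x => g x - m)).
      apply (continuous_minus g (fun _ => m)); [now apply Hc, Hin|apply continuous_const]. }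
    pose (m := (y + z) / 2).
    destruct (Hv u Hu) as [Eu|Eu], (Hv t Ht) as [Et|Et]; rewrite Eu, Et; trivial; exfalso.
    - destruct (IVT_interv (fun x => 1 * (g x - m)) u t) as (r & Hr & Hr0);
        try (rewrite ?Eu, ?Et; unfold m; lra); [now apply Hcont|].
      destruct (Hv r (Hin r Hr)) as [Er|Er]; rewrite Er in Hr0; unfold m in Hr0; lra.
    - destruct (IVT_interv (fun x => (- 1) * (g x - m)) u t) as (r & Hr & Hr0);
        try (rewrite ?Eu, ?Et; unfold m; lra); [now apply Hcont|].
      destruct (Hv r (Hin r Hr)) as [Er|Er]; rewrite Er in Hr0; unfold m in Hr0; lra. }
  intros u t Hu Ht.
  destruct (Rtotal_order u t) as [Hut|[->|Hut]]; [now apply K|reflexivity|].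
  symmetry; now apply K.
Qed.

Lemma is_vderive_cross c d u C D :
  is_vderive c u C -> is_vderive d u D ->
  is_vderive (fun t => cross (c t) (d t)) u (plus (cross C (d u)) (cross (c u) D)).
Proof.
  intros (H1 & H2 & H3) (K1 & K2 & K3).
  assert (M : forall f g f' g' l m l' m',
            is_derive f u l -> is_derive g u m -> is_derive f' u l' -> is_derive g' u m' ->
            is_derive (fun t => f t * g t - f' t * g' t) u
              ((l * g u - l' * g' u) + (f u * m - f' u * m'))).
  { intros f g f' g' l m l' m' Hf Hg Hf' Hg'.
    replace (l * g u - l' * g' u + (f u * m - f' u * m'))
      with ((l * g u + f u * m) - (l' * g' u + f' u * m')) by ring.
    exact (is_derive_minus _ _ u _ _ (is_derive_mult f g u l m Hf Hg Rmult_comm)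
                                     (is_derive_mult f' g' u l' m' Hf' Hg' Rmult_comm)). }
  split; [|split].
  - exact (M _ _ _ _ _ _ _ _ H2 K3 H3 K2).
  - exact (M _ _ _ _ _ _ _ _ H3 K1 H1 K3).
  - exact (M _ _ _ _ _ _ _ _ H1 K2 H2 K1).
Qed.

Lemma conical_curvature_lambda_continuous a b s e u :
  skew_ruled_surface a b s e -> in_I a b u ->
  continuous (fun t => conical_curvature e t * lambda s e t) u.
Proof.
  intros H Hu.
  destruct (skew_vderive _ _ _ _ _ H Hu) as ((DS & DS2) & DE & DE2 & DE3).
  assert (DZ := is_vderive_cross _ _ _ _ _ DE DE2).
  apply (ex_derive_continuous (V := R_NormedModule)).
  apply ex_derive_mult.
  - eexists; exact (is_derive_dot _ _ _ _ _ DZ DE3).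
  - apply ex_derive_div; [eexists; exact (is_derive_dot _ _ _ _ _ DE DS2)| |].
    + eexists; exact (is_derive_dot _ _ _ _ _ DZ DS2).
    + exact (skew_no_torsal _ _ _ _ H u Hu).
Qed.

(** * Osculating quadrics *)

(** The polar form of the quadratic part of Q, normalized so that
    [polar Q r r] is the quadratic part at r. *)
Definition polar (Q : quadric) (p r : V3) : R :=
  q11 Q * c1 p * c1 r + q22 Q * c2 p * c2 r + q33 Q * c3 p * c3 r
  + q12 Q * (c1 p * c2 r + c2 p * c1 r) / 2 + q13 Q * (c1 p * c3 r + c3 p * c1 r) / 2
  + q23 Q * (c2 p * c3 r + c3 p * c2 r) / 2.

Definition quadric_diff (Q : quadric) (p r : V3) : R :=
  2 * polar Q p r + q1 Q * c1 r + q2 Q * c2 r + q3 Q * c3 r.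

Lemma quadric_eval_plus Q p r :
  quadric_eval Q (plus p r) = quadric_eval Q p + quadric_diff Q p r + polar Q r r.
Proof. unfold quadric_eval, quadric_diff, polar; V3_coordinates; field. Qed.

Lemma polar_comb Q E N X Y Z X' Y' Z' :
  polar Q (comb E N X Y Z) (comb E N X' Y' Z') =
  X * X' * polar Q E E + Y * Y' * polar Q N N
  + Z * Z' * polar Q (cross E N) (cross E N)
  + (X * Y' + Y * X') * polar Q E N + (X * Z' + Z * X') * polar Q E (cross E N)
  + (Y * Z' + Z * Y') * polar Q N (cross E N).
Proof. unfold polar; V3_coordinates; field. Qed.

Lemma quadric_diff_comb Q p v E N X Y Z :
  quadric_diff Q (plus p (scal v E)) (comb E N X Y Z) =
  X * (quadric_diff Q p E + 2 * v * polar Q E E)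
  + Y * (quadric_diff Q p N + 2 * v * polar Q E N)
  + Z * (quadric_diff Q p (cross E N) + 2 * v * polar Q E (cross E N)).
Proof. unfold quadric_diff, polar; V3_coordinates; field. Qed.

Lemma is_derive_quadric_eval Q c u C :
  is_vderive c u C ->
  is_derive (fun t => quadric_eval Q (c t)) u (quadric_diff Q (c u) C).
Proof.
  intros (H1 & H2 & H3).
  (* [auto_derive] needs the coordinates as plain functions R -> R *)
  assert (K : forall f1 f2 f3 l1 l2 l3 : R -> R,
    is_derive f1 u (l1 u) -> is_derive f2 u (l2 u) -> is_derive f3 u (l3 u) ->
    is_derive (fun t => quadric_eval Q (f1 t, f2 t, f3 t)) u
      (quadric_diff Q (f1 u, f2 u, f3 u) (l1 u, l2 u, l3 u))).
  { intros f1 f2 f3 l1 l2 l3 F1 F2 F3.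
    unfold quadric_eval, quadric_diff, polar, c1, c2, c3; simpl.
    auto_derive; [repeat split; eexists; eassumption|].
    change (fun x => f1 x) with f1; change (fun x => f2 x) with f2;
      change (fun x => f3 x) with f3.
    rewrite (is_derive_unique _ _ _ F1), (is_derive_unique _ _ _ F2),
      (is_derive_unique _ _ _ F3); field. }
  exact (K _ _ _ (fun _ => c1 C) (fun _ => c2 C) (fun _ => c3 C) H1 H2 H3).
Qed.

Lemma is_derive_quadric_diff Q c d u C D :
  is_vderive c u C -> is_vderive d u D ->
  is_derive (fun t => quadric_diff Q (c t) (d t)) u
    (2 * polar Q C (d u) + quadric_diff Q (c u) D).
Proof.
  intros Hc Hd.
  assert (Hcd : is_vderive (fun t => plus (c t) (d t)) u (plus C D)).
  { destruct Hc as (H1 & H2 & H3), Hd as (K1 & K2 & K3); split; [|split].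
    - exact (is_derive_plus _ _ u _ _ H1 K1).
    - exact (is_derive_plus _ _ u _ _ H2 K2).
    - exact (is_derive_plus _ _ u _ _ H3 K3). }
  (* The differential is bilinear up to an affine term, so polarization
     expresses it through values of Q and of its quadratic part Q0. *)
  pose (Q0 := Build_quadric (q11 Q) (q22 Q) (q33 Q) (q12 Q) (q13 Q) (q23 Q)
                0 0 0 (q0 Q) (quadric_deg2 Q)).
  apply (is_derive_ext (fun t => quadric_eval Q (plus (c t) (d t)) - quadric_eval Q (c t)
                                 - (quadric_eval Q0 (d t) - q0 Q))).
  - intros t; unfold Q0, quadric_eval, quadric_diff, polar; V3_coordinates; simpl; field.
  - replace (2 * polar Q C (d u) + quadric_diff Q (c u) D)
      with (quadric_diff Q (plus (c u) (d u)) (plus C D) - quadric_diff Q (c u) C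
            - (quadric_diff Q0 (d u) D - 0))
      by (unfold Q0, quadric_diff, polar; V3_coordinates; simpl; field).
    apply @is_derive_minus; [apply @is_derive_minus|apply @is_derive_minus].
    + exact (is_derive_quadric_eval Q _ u _ Hcd).
    + exact (is_derive_quadric_eval Q _ u _ Hc).
    + exact (is_derive_quadric_eval Q0 _ u _ Hd).
    + apply @is_derive_const.
Qed.

Lemma polar_nonzero Q : exists r, polar Q r r <> 0.
Proof.
  apply NNPP; intros H; apply (quadric_deg2 Q).
  assert (K : forall x y z, polar Q (x, y, z) (x, y, z) = 0)
    by (intros x y z; apply NNPP; intros N; apply H; eexists; exact N).
  unfold polar, c1, c2, c3 in K; simpl in K.
  pose proof (K 1 0 0); pose proof (K 0 1 0); pose proof (K 0 0 1).
  pose proof (K 1 1 0); pose proof (K 1 0 1); pose proof (K 0 1 1).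
  repeat (apply f_equal2); lra.
Qed.

Lemma quadratic_coefficients A B C :
  (forall v, A * v ^ 2 + B * v + C = 0) -> A = 0 /\ B = 0 /\ C = 0.
Proof.
  intros H; pose proof (H 0); pose proof (H 1); pose proof (H (- 1)); lra.
Qed.

Lemma osculating_quadric_equations a b s e u Q :
  skew_ruled_surface a b s e -> in_I a b u -> osculating_quadric s e u Q ->
  forall v,
    let x := ruled s e u v in
    let xu := plus (vderive s u) (scal v (vderive e u)) in
    let xuu := plus (vderive (vderive s) u) (scal v (vderive (vderive e) u)) in
    quadric_eval Q x = 0 /\ quadric_diff Q x xu = 0 /\
    2 * polar Q xu xu + quadric_diff Q x xuu = 0.
Proof.
  intros H Hu HQ v x xu xuu.
  assert (D1 : forall t, in_I a b t ->
    is_derive (fun r => quadric_eval Q (ruled s e r v)) t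
      (quadric_diff Q (ruled s e t v) (plus (vderive s t) (scal v (vderive e t))))).
  { intros t Ht; apply (is_derive_quadric_eval Q (fun r => ruled s e r v)).
    destruct (skew_vderive _ _ _ _ _ H Ht) as ((DS & _) & DE & _).
    now apply is_vderive_ruled. }
  destruct (skew_vderive _ _ _ _ _ H Hu) as ((DS & DS2) & DE & DE2 & _).
  assert (D2 : is_derive (fun t => quadric_diff Q (ruled s e t v)
      (plus (vderive s t) (scal v (vderive e t)))) u
      (2 * polar Q xu xu + quadric_diff Q x xuu)).
  { apply (is_derive_quadric_diff Q (fun t => ruled s e t v)
      (fun t => ruled (vderive s) (vderive e) t v)); now apply is_vderive_ruled. }
  split; [|split].
  - exact (HQ v 0%nat ltac:(lia)).
  - rewrite <- (HQ v 1%nat ltac:(lia)); symmetry; exact (is_derive_unique _ _ _ (D1 u Hu)).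
  - rewrite <- (is_derive_unique _ _ _ D2), <- (HQ v 2%nat ltac:(lia)).
    simpl; apply Derive_ext_loc.
    apply (locally_in_I a b _ _ Hu); intros t Ht.
    symmetry; now apply is_derive_unique, D1.
Qed.

(** The conditions of contact say that three quadratic polynomials in v vanish.
    They determine the coefficients of Q in the frame (e, N, Z) based at s,
    up to the coefficient c of the XZ-term; c = 0 would kill the whole
    quadratic part. *)
Lemma osculating_quadric_frame_equation a b s e u Q :
  skew_ruled_surface a b s e -> in_I a b u -> osculating_quadric s e u Q ->
  let k := conical_curvature e u in
  let d := distribution_parameter s e u in let l := lambda s e u in
  let p := dot (vderive (vderive s) u) (cross (e u) (vderive e u)) in
  exists c, c <> 0 /\ forall X Y Z,
    quadric_eval Q (plus (s u) (comb (e u) (vderive e u) X Y Z)) =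
    c * (2 * X * Z - k * Y ^ 2 - p / d * Y * Z - (l + k) * Z ^ 2 - 2 * d * Y).
Proof.
  intros H Hu HQ k d l p.
  assert (O := skew_orthonormal _ _ _ _ _ H Hu).
  assert (Hd : d <> 0) by exact (skew_no_torsal _ _ _ _ H u Hu).
  assert (EQ := osculating_quadric_equations _ _ _ _ _ _ H Hu HQ).
  destruct (skew_frame_equations _ _ _ _ _ H Hu) as (HS & HE2 & HS2).
  fold k d l p in HS, HE2, HS2.
  set (q := dot (vderive (vderive s) u) (e u)) in HS2.
  rewrite HS2, HE2, HS in EQ; clear HS2 HE2 HS HQ.
  set (E := e u) in *; set (N := vderive e u) in *.
  assert (HX : forall v, plus (comb E N (d * l) 0 d) (scal v N) = comb E N (d * l) v d).
  { intros v; transitivity (plus (comb E N (d * l) 0 d) (scal v (comb E N 0 1 0))).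
    - now rewrite <- comb_N.
    - rewrite plus_scal_comb; f_equal; ring. }
  unfold ruled in EQ; fold E in EQ; cbv zeta in EQ.
  pose (aEE := polar Q E E); pose (aNN := polar Q N N).
  pose (aZZ := polar Q (cross E N) (cross E N)); pose (aEN := polar Q E N).
  pose (aEZ := polar Q E (cross E N)); pose (aNZ := polar Q N (cross E N)).
  pose (b0 := quadric_eval Q (s u)); pose (bE := quadric_diff Q (s u) E).
  pose (bN := quadric_diff Q (s u) N); pose (bZ := quadric_diff Q (s u) (cross E N)).
  destruct (quadratic_coefficients aEE bE b0) as (A1 & B1 & C1).
  { intros v; destruct (EQ v) as (K & _).
    rewrite <- K, quadric_eval_plus; unfold aEE, bE, b0, quadric_diff, polar.
    V3_coordinates; field. }
  destruct (quadratic_coefficients (2 * aEN) (2 * d * l * aEE + bN + 2 * d * aEZ)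
     (d * l * bE + d * bZ)) as (A2 & B2 & C2).
  { intros v; destruct (EQ v) as (_ & K & _).
    rewrite <- K, HX, quadric_diff_comb; fold aEE aEN aEZ bE bN bZ; ring. }
  destruct (quadratic_coefficients
     (2 * aNN - 2 * aEE + 2 * k * aEZ)
     (4 * d * l * aEN + 4 * d * aNZ + 2 * q * aEE - bE + 2 * d * (l - k) * aEN
       + 2 * p * aEZ + k * bZ)
     (2 * (d * l) ^ 2 * aEE + 2 * d ^ 2 * aZZ + 4 * d * l * d * aEZ
       + q * bE + d * (l - k) * bN + p * bZ)) as (A3 & B3 & C3).
  { intros v; destruct (EQ v) as (_ & _ & K).
    rewrite <- K, HX, plus_scal_comb, polar_comb, quadric_diff_comb.
    fold aEE aNN aZZ aEN aEZ aNZ bE bN bZ; ring. }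
  assert (EEN : aEN = 0) by lra.
  assert (EbZ : bZ = 0) by (apply (Rmult_eq_reg_l d); [nra|exact Hd]).
  assert (EbN : bN = - 2 * d * aEZ) by (rewrite A1 in B2; lra).
  assert (ENN : aNN = - k * aEZ) by lra.
  assert (ENZ : aNZ = - (p / d) / 2 * aEZ).
  { rewrite EEN, A1, B1, EbZ in B3; apply (Rmult_eq_reg_l (4 * d)); [|lra].
    field_simplify; [lra|exact Hd]. }
  assert (EZZ : aZZ = - (l + k) * aEZ).
  { rewrite A1, B1, EbZ, EbN in C3; apply (Rmult_eq_reg_l (2 * d ^ 2)); [lra|].
    apply Rgt_not_eq; pose proof (pow2_gt_0 d Hd); lra. }
  exists aEZ; split.
  - intros Hz; destruct (polar_nonzero Q) as (r & Hr); apply Hr.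
    rewrite (comb_coordinates E N r O), polar_comb.
    fold aEE aNN aZZ aEN aEZ aNZ; rewrite A1, EEN, ENN, ENZ, EZZ, Hz; ring.
  - intros X Y Z; rewrite quadric_eval_plus, polar_comb.
    replace (quadric_diff Q (s u) (comb E N X Y Z)) with (X * bE + Y * bN + Z * bZ)
      by (unfold bE, bN, bZ, quadric_diff, polar; V3_coordinates; field).
    fold aEE aNN aZZ aEN aEZ aNZ b0.
    rewrite A1, B1, C1, EEN, ENN, ENZ, EZZ, EbZ, EbN; field; exact Hd.
Qed.

(** Multiplied by l = lambda, the equation of the osculating quadric becomes
      |y|^2 - (1 + l^2) (y.a)^2 = (d l)^2
    for y = p - (s + d l N) and the unit vector a = (e - l Z) / sqrt (1 + l^2),
    which is the hyperboloid with axis a, gorge radius |d l| and conjugate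
    semi-axis |d|. *)
Lemma osculating_quadric_of_revolution a b s e u Q :
  skew_ruled_surface a b s e -> in_I a b u ->
  dot (vderive (vderive s) u) (cross (e u) (vderive e u)) = 0 ->
  conical_curvature e u * lambda s e u = - 1 ->
  osculating_quadric s e u Q -> hyperboloid_of_revolution Q.
Proof.
  intros H Hu Hp Hkl HQ.
  destruct (osculating_quadric_frame_equation _ _ _ _ _ _ H Hu HQ) as (c & Hc & HE).
  rewrite Hp in HE.
  assert (O := skew_orthonormal _ _ _ _ _ H Hu).
  assert (Hd : distribution_parameter s e u <> 0) by exact (skew_no_torsal _ _ _ _ H u Hu).
  set (k := conical_curvature e u) in *; set (d := distribution_parameter s e u) in *.
  set (l := lambda s e u) in *; set (E := e u) in *; set (N := vderive e u) in *.
  assert (Hl : l <> 0) by (intros Hl; rewrite Hl in Hkl; lra).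
  assert (Hr : 0 < 1 + l ^ 2) by (pose proof (pow2_ge_0 l); lra).
  pose (rho := sqrt (1 + l ^ 2)).
  assert (Hrho : rho ^ 2 = 1 + l ^ 2) by (apply pow2_sqrt; lra).
  assert (Hrho0 : rho <> 0) by (apply Rgt_not_eq, sqrt_lt_R0; exact Hr).
  exists (plus (s u) (comb E N 0 (d * l) 0)), (comb E N (/ rho) 0 (- l / rho)),
    (Rabs (d * l)), (Rabs d).
  split; [|split; [|split]].
  - unfold norm3; rewrite dot_comb by exact O.
    replace (/ rho * / rho + 0 * 0 + - l / rho * (- l / rho)) with ((1 + l ^ 2) / rho ^ 2)
      by (field; exact Hrho0).
    rewrite Hrho; unfold Rdiv; rewrite Rinv_r by lra; apply sqrt_1.
  - apply Rabs_pos_lt; now apply Rmult_integral_contrapositive.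
  - now apply Rabs_pos_lt.
  - intros p.
    pose (y := minus p (s u)).
    pose (X := dot y E); pose (Y := dot y N); pose (Z := dot y (cross E N)).
    assert (Hy : y = comb E N X Y Z) by now apply comb_coordinates.
    assert (HpQ : p = plus (s u) (comb E N X Y Z)).
    { rewrite <- Hy; apply V3_ext; V3_coordinates; unfold y; V3_coordinates; ring. }
    assert (Hpc : minus p (plus (s u) (comb E N 0 (d * l) 0)) = comb E N X (Y - d * l) Z).
    { rewrite HpQ; apply V3_ext; V3_coordinates; ring. }
    rewrite Hpc, !dot_comb by exact O.
    rewrite HpQ, HE, !pow2_abs.
    replace (X * / rho + (Y - d * l) * 0 + Z * (- l / rho)) with ((X - l * Z) / rho)
      by (field; exact Hrho0).
    replace (((X - l * Z) / rho) ^ 2) with ((X - l * Z) ^ 2 / rho ^ 2) by (field; exact Hrho0).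
    rewrite Hrho.
    assert (Hk : k = - / l) by (apply (Rmult_eq_reg_r l); [rewrite Hkl; field|]; exact Hl).
    rewrite Hk.
    assert (Heq : (X * X + (Y - d * l) * (Y - d * l) + Z * Z - (X - l * Z) ^ 2 / (1 + l ^ 2))
        / (d * l) ^ 2 - (X - l * Z) ^ 2 / (1 + l ^ 2) / d ^ 2 - 1 =
      (2 * X * Z - - / l * Y ^ 2 - 0 / d * Y * Z - (l + - / l) * Z ^ 2 - 2 * d * Y)
        / (d ^ 2 * l)) by (field; repeat split; trivial; lra).
    set (W := 2 * X * Z - _ - _ - _ - _) in *.
    split; intros K.
    + apply Rmult_integral in K as [K|K]; [contradiction|].
      rewrite K in Heq.
      assert (Z0 : 0 / (d ^ 2 * l) = 0) by apply Rmult_0_l.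
      lra.
    + assert (W0 : W / (d ^ 2 * l) = 0) by lra.
      assert (HW : W = W / (d ^ 2 * l) * (d ^ 2 * l)) by (field; split; assumption).
      rewrite HW, W0; ring.
Qed.

Theorem proposition4
    (a b : Rbar) (hab : Rbar_lt a b)
    (s e : R -> V3) (hPhi : skew_ruled_surface a b s e)
    (n : Z) (f : R -> R)
    (hf : forall u, in_I a b u -> continuous f u)
    (hkN : forall u v du dv,
       in_I a b u ->
       orthogonal_trajectory_direction (ruled s e) u v du dv ->
       normal_curvature (ruled s e) u v du dv = f u * powerRZ (striction_w s e u v) n) :
  ((forall u, in_I a b u -> f u = 0) /\ orthoid a b s e) \/
  (n = (-3)%Z /\
   (forall u, in_I a b u ->
      conical_curvature e u <> 0 /\
      f u = distribution_parameter s e u ^ 2 * / conical_curvature e u) /\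
   Edlinger a b s e).
Proof.
  pose proof (fun u Hu => normal_curvature_hypothesis_pointwise a b s e n (f u) u hPhi Hu
    (fun v du dv => hkN u v du dv Hu)) as P.
  destruct (classic (orthoid a b s e)) as [Horth|Horth]; [left|right].
  - split; [|exact Horth].
    intros u Hu; rewrite (proj1 (P u Hu)), (Horth u Hu); ring.
  - apply not_all_ex_not in Horth as (u0 & Hu0).
    apply imply_to_and in Hu0 as (Hu0 & Hl0).
    assert (Hkl : forall u, in_I a b u -> conical_curvature e u * lambda s e u = - 1).
    { intros u Hu; destruct (proj2 (P u0 Hu0) Hl0) as (_ & _ & K0); rewrite <- K0.
      apply (continuous_two_values (fun t => conical_curvature e t * lambda s e t)
        a b (- 1) 0); trivial; [lra| |].
      - intros t Ht; now apply (conical_curvature_lambda_continuous a b).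
      - intros t Ht; destruct (Req_dec (lambda s e t) 0) as [Z|Z].
        + right; rewrite Z; ring.
        + left; apply (P t Ht); exact Z. }
    assert (Hl : forall u, in_I a b u -> lambda s e u <> 0)
      by (intros u Hu Z; specialize (Hkl u Hu); rewrite Z in Hkl; lra).
    split; [now apply (P u0 Hu0)|split].
    + intros u Hu; specialize (Hkl u Hu).
      assert (Hk : conical_curvature e u <> 0) by (intros Z; rewrite Z in Hkl; lra).
      split; [exact Hk|].
      rewrite (proj1 (P u Hu)).
      assert (L : lambda s e u = - / conical_curvature e u)
        by (apply (Rmult_eq_reg_l (conical_curvature e u)); [rewrite Hkl; field|]; exact Hk).
      rewrite L; ring.
    + intros u Hu Q HQ.
      apply (osculating_quadric_of_revolution a b s e u); trivial; [|now apply Hkl].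
      now apply (P u Hu), Hl.
Qed.
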